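(* Let $R$ be a commutative ring with finite Goldie dimension. The following are equivalent: (a) $R$ is a dual Kasch ring. (b) $R$ is a classical ring. (c) $\mathfrak{m}E\neq E$ for each maximal ideal $\mathfrak{m}$ of $R$, where $E=E(R)$. If moreover $R$ is Noetherian, then the following condition is also equivalent to (a), (b) and (c): (d) $R$ is a Kasch ring.
   Context: Rings are associative, unital and non-trivial; modules are unital. $E(R)$ is the injective hull of $R$ as an $R$-module. A commutative ring $R$ is dual Kasch if every simple $R$-module is isomorphic to a factor module of an injective $R$-module, and Kasch if every simple $R$-module embeds into $R$. A ring is classical if every element is either a zero divisor or invertible ($0$ counts as a zero divisor). Finite Goldie dimension means that $R$ contains no infinite direct sum of non-zero ideals. *)

(* Defs.v *)
From HB Require Import structures.
From mathcomp Require Import all_boot all_order all_algebra.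
From mathcomp Require Import boolp classical_sets functions.

Set Implicit Arguments.
Unset Strict Implicit.
Unset Printing Implicit Defensive.

Import GRing.Theory.

Local Open Scope classical_set_scope.
Local Open Scope ring_scope.

Section Modules.
Variable R : comNzRingType.
Implicit Types M E : lmodType R.

(* Membership in a [set] is a boolean predicate thanks to the classical
   axioms, so that [submodule] ranges over all submodules. *)
Definition submodule M (N : set M) : Prop := submod_closed [in N].

Definition simple_module M : Prop :=
  (exists x : M, x != 0) /\
  forall N : set M, submodule N -> N = [set 0] \/ N = setT.

Definition injective_module E : Prop :=
  forall (A B : lmodType R) (f : {linear A -> B}) (g : {linear A -> E}),
    injective f -> exists h : {linear B -> E}, forall x, h (f x) = g x.

(* By the first isomorphism theorem, the modules isomorphic to some M / N are
   exactly the targets of surjective linear maps from M. *)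
Definition iso_to_factor_module M M' : Prop :=
  exists f : {linear M -> M'}, range f = setT.

Definition embeds M M' : Prop := exists f : {linear M -> M'}, injective f.

(* E is an injective essential extension of M, through i. *)
Definition injective_hull M E (i : {linear M -> E}) : Prop :=
  [/\ injective_module E, injective i &
      forall N : set E, submodule N -> N `&` range i = [set 0] -> N = [set 0]].

(* The submodule I M of finite sums of products of elements of I and M. *)
Definition ideal_mul (I : set R) M : set M :=
  [set x | exists (n : nat) (a : 'I_n -> R) (y : 'I_n -> M),
     (forall k, I (a k)) /\ x = \sum_(k < n) a k *: y k].

End Modules.

Arguments ideal_mul {R} I M.

Section Rings.
Variable R : comNzRingType.

Definition ideal (I : set R) : Prop := @submodule R R^o I.

Definition maximal_ideal (m : set R) : Prop :=
  [/\ ideal m, m <> setT &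
      forall I : set R, ideal I -> m `<=` I -> I = m \/ I = setT].

(* The sum of the ideals I k is direct. *)
Definition independent_ideals (I : nat -> set R) : Prop :=
  forall (n : nat) (x : 'I_n -> R), (forall k : 'I_n, I k (x k)) ->
    \sum_(k < n) x k = 0 -> forall k, x k = 0.

(* Any infinite direct sum contains one indexed by nat. *)
Definition finite_Goldie_dimension : Prop :=
  ~ exists I : nat -> set R,
      (forall k, ideal (I k) /\ I k <> [set 0]) /\ independent_ideals I.

Definition noetherian : Prop :=
  forall I : nat -> set R, (forall n, ideal (I n)) ->
    (forall n, I n `<=` I n.+1) ->
    exists N, forall n, (N <= n)%N -> I n = I N.

Definition zero_divisor (x : R) : Prop := exists2 y : R, y != 0 & x * y = 0.

Definition invertible (x : R) : Prop := exists y : R, x * y = 1.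

Definition classical_ring : Prop :=
  forall x : R, zero_divisor x \/ invertible x.

Definition dual_Kasch : Prop :=
  forall S : lmodType R, simple_module S ->
    exists2 E : lmodType R, injective_module E & iso_to_factor_module E S.

Definition Kasch : Prop :=
  forall S : lmodType R, simple_module S -> embeds S R^o.

(* m E(R) <> E(R) for every maximal ideal m.  The hull E(R) exists and is
   unique up to isomorphism, so the condition is stated for any model of it. *)
Definition hull_maximal_ideals_proper : Prop :=
  forall (E : lmodType R) (i : {linear R^o -> E}), injective_hull i ->
    forall m : set R, maximal_ideal m -> ideal_mul m E <> setT.

End Rings.

(* Main.v *)
Require Import Defs.
From HB Require Import structures.
From mathcomp Require Import all_boot all_order all_algebra.
From mathcomp Require Import boolp classical_sets functions.

(** Why the theorem is true.

    An injective module is divisible by every non-zero-divisor x.  If such an x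
    were not invertible, it would lie in a maximal ideal m, and the simple
    module R/m, on which x acts as 0, could not be an image of a module on which
    x is surjective: dual Kasch rings are classical
    ([dual_Kasch_classical]).

    In a classical ring every maximal ideal m consists of zero divisors.  The
    finite Goldie dimension upgrades this to finite subsets: any finitely many
    elements of m have a common non-zero annihilator
    ([finite_common_annihilator]).  Call u uniform when any two non-zero
    submodules of Ru meet.  The elements that kill some non-zero multiple of u
    then form a prime ideal P_u, and finitely many elements of P_u kill the same
    non-zero multiple of u.  So if a finite part of m had no common annihilator,
    m would lie in no P_u; given uniform u_0, ..., u_(n-1), prime avoidance
    gives x in m outside all their primes, and any uniform u_n killed by x is
    independent of the previous ones.  Iterating contradicts finite Goldie
    dimension.

    Now if mE = E, write 1 = sum_k a_k y_k in E with a_k in m; a common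
    annihilator of the a_k kills 1, which is absurd
    ([classical_hull_proper]).  Conversely let S = R s0 be simple, m the
    annihilator of s0 and v an element of E outside mE.  A submodule N
    containing mE and maximal among those avoiding v satisfies E = N + Rv, and
    n + r v |-> r s0 maps E onto S ([factor_onto_simple]).  This
    uses that R has an injective hull, which is built from scratch
    ([injective_hull_exists]).

    Finally, a Kasch ring is classical because the image y of 1 under an
    embedding of R/m into R satisfies m y = 0.  Over a Noetherian ring, some
    finite part of m has the same annihilator as m, so the common annihilators
    above kill all of m and give embeddings of the simple modules into R
    ([classical_Kasch]). *)

Set Implicit Arguments.
Unset Strict Implicit.
Unset Printing Implicit Defensive.

Import Order.TTheory GRing.Theory Num.Theory.
Local Open Scope classical_set_scope.
Local Open Scope ring_scope.

(** * Submodules and quotient modules *)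

Section Submodules.
Variables (R : comNzRingType) (M : lmodType R).
Implicit Types N : set M.

Lemma submoduleP N :
  N 0 -> (forall a u v, N u -> N v -> N (a *: u + v)) -> submodule N.
Proof.
move=> N0 NL; split=> [|a u v]; rewrite ?inE //.
exact: NL.
Qed.

Lemma submodule0 N : submodule N -> N 0.
Proof. by case; rewrite inE. Qed.

Lemma submoduleL N a u v : submodule N -> N u -> N v -> N (a *: u + v).
Proof. by case=> _ /(_ a u v); rewrite !inE. Qed.

Lemma submoduleD N u v : submodule N -> N u -> N v -> N (u + v).
Proof. by move=> HN Nu Nv; rewrite -[u]scale1r; apply: submoduleL. Qed.

Lemma submoduleZ N a u : submodule N -> N u -> N (a *: u).
Proof.
by move=> HN Nu; rewrite -[_ *: _]addr0; apply: submoduleL => //;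
  apply: submodule0.
Qed.

Lemma submoduleN N u : submodule N -> N u -> N (- u).
Proof. by move=> HN Nu; rewrite -scaleN1r; apply: submoduleZ. Qed.

Lemma submoduleB N u v : submodule N -> N u -> N v -> N (u - v).
Proof. by move=> HN Nu Nv; apply: submoduleD => //; apply: submoduleN. Qed.

(** The only use of Zorn's lemma.  For suitable A it yields maximal ideals,
    complements of submodules and maximal partial homomorphisms. *)
Lemma submodule_avoiding (A B : set M) :
    submodule B -> B `&` A = set0 ->
  exists C, [/\ submodule C, B `<=` C, C `&` A = set0 &
    forall D, submodule D -> C `<=` D -> D `&` A = set0 -> D = C].
Proof.
move=> HB BA.
(* The empty set is admitted because the union of the empty chain is empty. *)
pose P (X : set M) := X = set0 \/ [/\ submodule X, B `<=` X & X `&` A = set0].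
have [F FP Ftot|C [PC maxC]] := @Zorn_bigcup M P.
  have [[X FX /eqP/set0P[x Xx]]|F0] :=
    pselect (exists2 X, F X & X <> set0); last first.
    left; apply/seteqP; split=> // z [X FX Xz].
    by case: F0; exists X => //; apply/eqP/set0P; exists z.
  right.
  have good Y y : F Y -> Y y -> [/\ submodule Y, B `<=` Y & Y `&` A = set0].
    by move=> FY Yy; case: (FP _ FY) => // Y0; rewrite Y0 in Yy.
  split.
  - apply: submoduleP => [|a u v [U FU Uu] [V FV Vv]].
      by exists X => //; apply: submodule0; case: (good _ _ FX Xx).
    have [UV|VU] := Ftot _ _ FU FV.
      exists V => //; apply: submoduleL => //; last exact: UV.
      by case: (good _ _ FV Vv).
    exists U => //; apply: submoduleL => //; last exact: VU.
    by case: (good _ _ FU Uu).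
  - by move=> b Bb; exists X => //; case: (good _ _ FX Xx) => _ BX _; apply: BX.
  - apply/seteqP; split=> // y [[Y FY Yy] Ay].
    by case: (good _ _ FY Yy) => _ _ <-; split.
have PB : P B by right; split.
have {PC}[C0|[HC BC CA]] := PC.
  exfalso; apply: (maxC B) => //; rewrite C0 properEneq; split=> //.
  by apply/eqP => B0; have := submodule0 HB; rewrite -B0.
exists C; split=> // D HD CD DA; apply: contrapT => DC.
apply: (maxC D); last by right; split=> //; apply: subset_trans CD.
by rewrite properEneq; split=> //; apply/eqP => CeD; apply: DC.
Qed.

Section SubType.
Variables (N : set M) (HN : submodule N).

(** The proof argument is a key: it lets canonical structures recover that the
    predicate is closed under the module operations. *)
Definition submodule_pred of submodule N : pred M := [in N].
HB.instance Definition _ :=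
  GRing.isSubmodClosed.Build R M (submodule_pred HN)
    (GRing.submod_closed_semi HN).

Definition submod : Type := {x : M | submodule_pred HN x}.
HB.instance Definition _ := SubType.on submod.
HB.instance Definition _ := [Choice of submod by <:].
HB.instance Definition _ := [SubChoice_isSubLmodule of submod by <:].

Lemma submod_valP (x : submod) : N (val x).
Proof. by have := valP x; rewrite /submodule_pred inE. Qed.

Definition mk_submod (x : M) (Nx : N x) : submod := Sub x (mem_set Nx).

Local Notation Nz := (GRing.ZmodClosed.clone M (submodule_pred HN) _).

Definition quotmod : Type := Quotient.quot Nz.
HB.instance Definition _ := GRing.Zmodule.on quotmod.

Definition quotmod_pi (x : M) : quotmod :=
  \pi_(Quotient.quot Nz)%qT x.

Lemma quotmod_piE x y : quotmod_pi x = quotmod_pi y <-> N (x - y).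
Proof.
rewrite /quotmod_pi; split=> [/eqP|Nxy].
  by rewrite -Quotient.idealrBE /submodule_pred inE.
by apply/eqP; rewrite -Quotient.idealrBE /submodule_pred inE.
Qed.

Lemma quotmod_pi_surj (q : quotmod) : exists x, quotmod_pi x = q.
Proof. by exists (repr q); rewrite /quotmod_pi reprK. Qed.

Lemma quotmod_piD : {morph quotmod_pi : x y / x + y}.
Proof. exact: raddfD. Qed.

Definition quotmod_scale (a : R) (q : quotmod) : quotmod :=
  quotmod_pi (a *: repr q).

Lemma quotmod_piZ a x : quotmod_scale a (quotmod_pi x) = quotmod_pi (a *: x).
Proof.
apply/quotmod_piE; rewrite -scalerBr; apply: submoduleZ => //.
by apply/quotmod_piE; rewrite /quotmod_pi reprK.
Qed.

Fact quotmod_scaleA a b q :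
  quotmod_scale a (quotmod_scale b q) = quotmod_scale (a * b) q.
Proof.
by have [x <-] := quotmod_pi_surj q; rewrite !quotmod_piZ scalerA.
Qed.

Fact quotmod_scale1 : left_id 1 quotmod_scale.
Proof.
by move=> q; have [x <-] := quotmod_pi_surj q; rewrite quotmod_piZ scale1r.
Qed.

Fact quotmod_scaleDr : right_distributive quotmod_scale +%R.
Proof.
move=> a p q; have [x <-] := quotmod_pi_surj p.
have [y <-] := quotmod_pi_surj q.
by rewrite -quotmod_piD !quotmod_piZ -quotmod_piD scalerDr.
Qed.

Fact quotmod_scaleDl q : {morph quotmod_scale^~ q : a b / a + b}.
Proof.
move=> a b; have [x <-] := quotmod_pi_surj q.
by rewrite !quotmod_piZ -quotmod_piD scalerDl.
Qed.

HB.instance Definition _ := GRing.Zmodule_isLmodule.Build R quotmod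
  quotmod_scaleA quotmod_scale1 quotmod_scaleDr quotmod_scaleDl.

Lemma quotmod_pi_is_linear : linear quotmod_pi.
Proof. by move=> a x y; rewrite quotmod_piD -quotmod_piZ. Qed.

HB.instance Definition _ :=
  GRing.isLinear.Build R M quotmod *:%R quotmod_pi quotmod_pi_is_linear.

End SubType.
End Submodules.
Arguments quotmod_pi {R M N}.

(** * Common annihilators in rings of finite Goldie dimension *)

Section Annihilators.
Variable R : comNzRingType.
Implicit Types (I J P : set R) (u x y : R).

Lemma idealM J a x : ideal J -> J x -> J (a * x).
Proof. by move=> HJ Jx; apply: (@submoduleZ R R^o J a x). Qed.

Lemma proper_ideal1 J : ideal J -> J <> setT -> ~ J 1.
Proof.
move=> HJ JT J1; apply: JT; apply/seteqP; split=> // x _.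
by rewrite -[x]mulr1; apply: idealM.
Qed.

Lemma principal_ideal u : ideal (range ( *%R^~ u)).
Proof.
apply: (@submoduleP R R^o); first by exists 0; rewrite ?mul0r.
move=> a _ _ [r _ <-] [s _ <-]; exists (a * r + s) => //=.
by rewrite mulrDl -mulrA.
Qed.

Definition independent (u : nat -> R) : Prop :=
  forall n (r : nat -> R), \sum_(k < n) r k * u k = 0 ->
    forall k, (k < n)%N -> r k * u k = 0.

(** The principal ideals of the u k would form an infinite direct sum. *)
Lemma finite_Goldie_not_independent (u : nat -> R) :
  finite_Goldie_dimension R -> (forall k, u k != 0) -> ~ independent u.
Proof.
move=> hR u0 iu; apply: hR; exists (fun k => range ( *%R^~ (u k))); split.
  move=> k; split; first exact: principal_ideal.
  move=> I0; have : range ( *%R^~ (u k)) (u k) by exists 1; rewrite ?mul1r.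
  by rewrite I0 => /eqP; apply/negP.
move=> n x Ix sum0 k.
have /choice[r rP] (i : 'I_n) : exists r, r * u i = x i.
  by have [r _ <-] := Ix i; exists r.
pose r' i := if insub i is Some j then r j else 0.
have r'E (i : 'I_n) : r' i = r i by rewrite /r' valK.
rewrite -rP -r'E; apply: (iu n) => //.
by rewrite -[RHS]sum0; apply: eq_bigr => i _; rewrite r'E rP.
Qed.

(** This says that the module Ru is uniform: any two non-zero submodules meet. *)
Definition uniform u : Prop :=
  u != 0 /\ forall r s, r * u != 0 -> s * u != 0 ->
    exists p q, p * (r * u) = q * (s * u) /\ p * (r * u) != 0.

(** Otherwise every non-zero multiple b of y has two non-zero multiples with
    independent spans.  Keep the first one and split the second one again: the
    elements kept in this way are independent. *)
Lemma uniform_multiple y :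
  finite_Goldie_dimension R -> y != 0 -> exists r, uniform (r * y).
Proof.
move=> hR y0; apply: contrapT => nU.
pose good b := b != 0 /\ exists r, b = r * y.
have /choice[F FP] b : exists p : R * R, good b ->
    [/\ p.1 != 0, good p.2, (exists r, p.1 = r * b), (exists r, p.2 = r * b) &
        forall r s, r * p.1 = s * p.2 -> r * p.1 = 0].
  have [gb|nb] := pselect (good b); last by exists (0, 0).
  apply: contrapT => H; apply: nU; case: (gb) => b0 [r br]; exists r.
  rewrite -br; split=> // s t sb tb; apply: contrapT => H'; apply: H.
  exists (s * b, t * b) => _ /=; split=> //.
  - by split=> //; exists (t * r); rewrite br mulrA.
  - by exists s.
  - by exists t.
  move=> p q pq; apply/eqP; apply: contrapT => /negP pne.
  by apply: H'; exists p, q.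
pose b n := iter n (fun c => (F c).2) y.
pose a n := (F (b n)).1.
have gb n : good (b n).
  elim: n => [|n IH]; first by split=> //; exists 1; rewrite mul1r.
  by case: (FP _ IH).
apply: (@finite_Goldie_not_independent a) => // [k|n r].
  by case: (FP _ (gb k)).
(* All later elements lie in the half that was split at stage m. *)
have tail m d (c : nat -> R) : exists t,
    \sum_(k < d) c k * a (m + k)%N = t * b m.
  elim: d m c => [|d IH] m c; first by exists 0; rewrite big_ord0 mul0r.
  rewrite big_ord_recl addn0.
  have [t Et] := IH m.+1 (fun k => c k.+1).
  case: (FP _ (gb m)) => _ _ [v Ev] [w Ew] _.
  exists (c 0%N * v + t * w).
  rewrite mulrDl -!mulrA -Ev -Ew; congr (_ + _); rewrite -[RHS]Et.
  by apply: eq_bigr => k _; rewrite /bump /= addnS.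
have key m : forall c : nat -> R, \sum_(k < n) c k * a (m + k)%N = 0 ->
    forall k, (k < n)%N -> c k * a (m + k)%N = 0.
  elim: n m => // n IH m c; rewrite big_ord_recl addn0 => s0.
  have [t Et] := tail m.+1 n (fun k => c k.+1).
  have Es : \sum_(i < n) c (bump 0 i) * a (m + bump 0 i)%N = t * b m.+1.
    by rewrite -[RHS]Et; apply: eq_bigr => k _; rewrite /bump /= addnS.
  case: (FP _ (gb m)) => _ _ _ _ /(_ (c 0%N) (- t)) c0.
  have {}c0 : c 0%N * a m = 0.
    by apply: c0; rewrite mulNr; apply/eqP; rewrite -addr_eq0 -Es s0.
  rewrite c0 add0r in s0.
  case=> [_|k kn]; first by rewrite addn0.
  have := IH m.+1 (fun k => c k.+1); rewrite -addSnnS; apply=> //.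
  by rewrite -[RHS]s0; apply: eq_bigr => i _; rewrite /bump /= addnS.
exact: (key 0%N).
Qed.

(** For uniform u, this is the prime ideal associated with the module Ru. *)
Definition assassin u : set R :=
  [set a | exists2 r, r * u != 0 & a * (r * u) = 0].

Definition prime_set P : Prop :=
  ideal P /\ forall a b, P (a * b) -> P a \/ P b.

(** For the sum of two elements, that their annihilated multiples have a common
    non-zero multiple is exactly uniformity. *)
Lemma uniform_prime u : uniform u -> prime_set (assassin u).
Proof.
case=> u0 uU; split.
  apply: (@submoduleP R R^o).
    by exists 1; rewrite ?mul1r ?mul0r.
  move=> a x y [r ru xr] [s su ys].
  have [p [q [pq p0]]] := uU r s ru su.
  exists (p * r); rewrite -?mulrA // mulrDl {2}pq.
  by rewrite -[a *: x]/(a * x) -mulrA !(mulrCA _ p) (mulrCA _ q) xr ys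
    !mulr0 addr0.
move=> a b [r ru abr].
have [br|br] := eqVneq (b * (r * u)) 0; first by right; exists r.
by left; exists (b * r); rewrite -?mulrA // mulrA.
Qed.

(** Uniformity merges the multiples of u killed by each element of s into one
    multiple killed by all of them. *)
Lemma uniform_common_annihilator u (s : seq R) :
  uniform u -> (forall a, a \in s -> assassin u a) ->
  exists2 r, r * u != 0 & forall a, a \in s -> a * (r * u) = 0.
Proof.
move=> uU; elim: s => [_|a s IH sP].
  by exists 1; rewrite ?mul1r //; case: uU.
have [|r ru rs] := IH; first by move=> b bs; apply: sP; rewrite inE bs orbT.
have [|t tu at0] := sP a; first by rewrite inE eqxx.
have [p [q [pq p0]]] := uU.2 r t ru tu.
exists (p * r); rewrite -?mulrA // => b; rewrite inE => /predU1P[->|bs].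
  by rewrite pq mulrCA at0 mulr0.
by rewrite mulrCA rs // mulr0.
Qed.

(** Primes contained in the first prime P can be discarded.  If the x avoiding
    the others lies in P, then add to it an element y of J outside P that lies
    in all the others: a product of elements witnessing the non-inclusions. *)
Lemma prime_avoidance J (Ps : seq (set R)) :
    ideal J -> (forall P, P \in Ps -> prime_set P) ->
    (forall P, P \in Ps -> ~ J `<=` P) ->
  exists2 x, J x & forall P, P \in Ps -> ~ P x.
Proof.
move=> HJ; have [n] := ubnP (size Ps); elim: n Ps => // n IH.
case=> [_ _ _|P Qs /= sQ prP nJ]; first by exists 0 => //; apply: submodule0 HJ.
pose Ts := [seq Q <- Qs | ~~ `[< Q `<=` P >]].
have TQ Q : Q \in Ts -> Q \in Qs by rewrite mem_filter => /andP[].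
have [|Q /TQ QQ|Q /TQ QQ|x Jx xT] := IH Ts.
- by rewrite size_filter; apply: leq_ltn_trans (count_size _ _) _.
- by apply: prP; rewrite inE QQ orbT.
- by apply: nJ; rewrite inE QQ orbT.
have [HP primeP] : prime_set P by apply: prP; rewrite inE eqxx.
suff [z [Jz Pz zT]] : exists z, [/\ J z, ~ P z & forall Q, Q \in Ts -> ~ Q z].
  exists z => // Q; rewrite inE => /predU1P[-> //|QQ].
  have [QP|QP] := pselect (Q `<=` P); first by move=> /QP.
  by apply: zT; rewrite mem_filter QQ andbT; apply/asboolPn.
have [Px|Px] := pselect (P x); last by exists x.
have [y [Jy yT Py]] : exists y, [/\ J y, forall Q, Q \in Ts -> Q y & ~ P y].
  have : forall Q, Q \in Ts -> ideal Q /\ ~ Q `<=` P.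
    move=> Q QT; split; first by case: (prP Q); rewrite // inE TQ ?orbT.
    by move: QT; rewrite mem_filter => /andP[/asboolPn].
  elim: Ts {TQ xT} => [_|Q Ts IHT HT].
    have /existsNP[y /not_implyP[Jy Py]] : ~ J `<=` P.
      by apply: nJ; rewrite inE eqxx.
    by exists y.
  have [|y [Jy yT Py]] := IHT.
    by move=> T TT; apply: HT; rewrite inE TT orbT.
  have [|HQ /existsNP[q /not_implyP[Qq Pq]]] := HT Q; first by rewrite inE eqxx.
  exists (q * y); split; first exact: idealM.
    move=> T; rewrite inE => /predU1P[->|TT].
      by rewrite mulrC; apply: idealM.
    apply: idealM; last exact: yT.
    by have [|] := HT T; rewrite ?inE ?TT ?orbT.
  by move=> /primeP[].
exists (x + y); split; first exact: (@submoduleD R R^o).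
  move=> Pxy; apply: Py; rewrite -[y](addKr x) addrC.
  exact: (@submoduleB R R^o).
move=> Q QT Qxy; apply: (xT Q QT); rewrite -[x](addrK y).
apply: (@submoduleB R R^o) => //; last exact: yT.
by case: (prP Q); rewrite // inE TQ ?orbT.
Qed.

(** If the finite family s had no common annihilator, J would lie in no prime
    [assassin v] with v uniform.  Hence from uniform elements t one finds x in J
    outside all their primes, and a uniform w killed by x.  Multiplying a
    relation between w and t by x shows that w is independent of t. *)
Lemma finite_common_annihilator J (s : seq R) :
    finite_Goldie_dimension R -> ideal J -> (forall x, J x -> zero_divisor x) ->
    (forall a, a \in s -> J a) ->
  exists2 y, y != 0 & forall a, a \in s -> a * y = 0.
Proof.
move=> hR HJ Jzd sJ; apply: contrapT => noy.
pose all_uniform (t : seq R) := forall v, v \in t -> uniform v.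
have /choice[F FP] (t : seq R) : exists w : R, all_uniform t ->
    uniform w /\ exists2 x, x * w = 0 & forall v, v \in t -> ~ assassin v x.
  have [tU|] := pselect (all_uniform t); last by exists 0.
  have [P /mapP[v vt ->]|P /mapP[v vt ->] JP|x Jx xP] :=
    @prime_avoidance J [seq assassin v | v <- t] HJ.
  - exact/uniform_prime/tU.
  - apply: noy; have [|r ru rs] := uniform_common_annihilator (s := s) (tU v vt).
      by move=> a /sJ/JP.
    by exists (r * v).
  have [y y0 xy] := Jzd x Jx.
  have [r ry] := uniform_multiple hR y0.
  exists (r * y) => _; split=> //; exists x; first by rewrite mulrCA xy mulr0.
  by move=> v vt; apply: xP; apply: map_f.
pose S n := iter n (fun t => F t :: t) [::].
pose u n := F (S n).
have SU n : all_uniform (S n).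
  elim: n => [//|n IH] v; rewrite inE => /predU1P[->|]; last exact: IH.
  by case: (FP _ IH).
have uS k n : (k < n)%N -> u k \in S n.
  elim: n => // n IH; rewrite ltnS leq_eqVlt => /predU1P[->|/IH kn].
    by rewrite inE eqxx.
  by rewrite inE kn orbT.
apply: (@finite_Goldie_not_independent u) => // [k|].
  by case: (FP _ (SU k)) => -[].
elim=> // n IH r; rewrite big_ord_recr /= => sum0.
have [_ [x xu xP]] := FP _ (SU n).
have lt0 k : (k < n)%N -> r k * u k = 0.
  move=> kn; apply/eqP; apply: contrapT => /negP ne.
  apply: (xP (u k) (uS _ _ kn)); exists (r k) => //.
  rewrite mulrA; apply: (IH (fun k => x * r k)) => //.
  have : x * (\sum_(i < n) r i * u i + r n * u n) = 0 by rewrite sum0 mulr0.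
  rewrite mulrDr (mulrCA x (r n)) xu mulr0 addr0 mulr_sumr => H.
  by rewrite -[RHS]H; apply: eq_bigr => i _; rewrite mulrA.
move=> k; rewrite ltnS leq_eqVlt => /predU1P[->|/lt0 //].
move: sum0; rewrite big1 ?add0r // => i _; exact: lt0.
Qed.

End Annihilators.

(** * Linear maps given by their graphs *)

Section LinearMaps.
Variables (R : comNzRingType) (B D : lmodType R).

Lemma range_submodule (f : {linear B -> D}) : submodule (range f).
Proof.
apply: submoduleP => [|a _ _ [x _ <-] [y _ <-]].
  by exists 0 => //; rewrite linear0.
by exists (a *: x + y) => //; rewrite linearP.
Qed.

Lemma linear_bundle (f : B -> D) :
  linear f -> exists h : {linear B -> D}, h =1 f.
Proof.
move=> Hf; pose i := GRing.isLinear.Build R B D *:%R f Hf.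
by exists (HB.pack_for {linear B -> D} f i).
Qed.

Definition single_valued (G : set (B * D)) : Prop :=
  forall d, G (0, d) -> d = 0.

Lemma single_valued_eq (G : set (B * D)) b d d' :
  submodule G -> single_valued G -> G (b, d) -> G (b, d') -> d = d'.
Proof.
move=> HG sv Gd Gd'; apply/eqP; rewrite -subr_eq0; apply/eqP/sv.
by rewrite -(subrr b); apply: (submoduleB HG Gd Gd').
Qed.

(** Maps on sums N + Rv or on cyclic modules are easier to describe by their
    graph than by a formula, since representatives are not unique. *)
Lemma graph_linear (G : set (B * D)) :
    submodule G -> single_valued G -> (forall b, exists d, G (b, d)) ->
  exists h : {linear B -> D}, forall b d, G (b, d) -> h b = d.
Proof.
move=> HG sv /choice[h Gh].
have [|k kh] := @linear_bundle h.
  move=> a x y; apply: (single_valued_eq HG sv (Gh _)).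
  exact: (submoduleL a HG (Gh x) (Gh y)).
by exists k => b d /(single_valued_eq HG sv (Gh b)) <-.
Qed.

End LinearMaps.

(** * Extension of homomorphisms over the integers *)

Section IntegerModules.

Lemma int_ideal_principal (H : set int) :
  ideal H -> exists k : nat, forall n, H n <-> exists q, n = q * k%:Z.
Proof.
move=> HH; have HM := idealM _ HH.
have [exk|nok] := pselect (exists k : nat, (0 < k)%N && `[< H k%:Z >]).
  case: (ex_minnP exk) => k /andP[k0 /asboolP Hk] kmin.
  exists k => n; split=> [Hn|[q ->]]; last exact: HM.
  exists (n %/ k)%Z; rewrite [LHS](divz_eq n k).
  have Hr : H (n %% k)%Z.
    have -> : (n %% k)%Z = n - (n %/ k)%Z * k.
      by rewrite {2}(divz_eq n k) addrC addKr.
    by apply: (@submoduleB int int^o) => //; apply: HM.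
  have : (n %% k)%Z < k by rewrite ltz_pmod.
  have : 0 <= (n %% k)%Z by rewrite modz_ge0 // -lt0n.
  case: (n %% k)%Z Hr => // -[|j] Hj _ jk; first by rewrite addr0.
  have := kmin j.+1; rewrite /= asboolT // => /(_ isT).
  by rewrite leqNgt -ltz_nat jk.
exists 0%N => n; split=> [Hn|[q ->]]; last first.
  by rewrite mulr0; apply: (@submodule0 int int^o).
exists 0; rewrite mul0r; apply/eqP; apply: contrapT => /negP n0; apply: nok.
exists `|n|%N; rewrite absz_gt0 n0; apply/asboolP.
by rewrite abszE -[`|n|]/(Num.norm n) normrEsg; apply: HM.
Qed.

(** Baer's argument, with partial homomorphisms encoded as single-valued
    submodules of the product, that is, submodules avoiding the pairs (0, d)
    with d non-zero.  Let G be a maximal one and b an element.  The integers n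
    with n b in the domain of G are the multiples of some k; dividing the value
    of G at k b by k gives a compatible value d0 at b. *)
Lemma divisible_extension (B D : lmodType int) (G0 : set (B * D)) :
    (forall n : int, n != 0 -> forall d : D, exists e : D, n *: e = d) ->
    submodule G0 -> single_valued G0 ->
  exists h : {linear B -> D}, forall b d, G0 (b, d) -> h b = d.
Proof.
move=> divD HG0 sv0.
have [|G [HG G0G GA Gmax]] :=
    @submodule_avoiding _ (B * D)%type [set p | p.1 = 0 /\ p.2 <> 0] G0 HG0.
  apply/seteqP; split=> // -[b d] [/= Gbd [b0 d0]].
  by apply/d0/sv0; rewrite -b0.
have sv : single_valued G.
  move=> d Gd; apply: contrapT => d0.
  by rewrite -[False]/(set0 ((0 : B), d)) -GA; split.
suff totG b : exists d, G (b, d).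
  by have [h hG] := graph_linear HG sv totG; exists h => b d /G0G/hG.
have [|k kP] := @int_ideal_principal [set n | exists d, G (n *: b, d)].
  apply: (@submoduleP int int^o) => [|a n m [d Gd] [e Ge]].
    by exists 0; rewrite scale0r; apply: (submodule0 HG).
  exists (a *: d + e); rewrite scalerDl -scalerA.
  exact: (submoduleL a HG Gd Ge).
have [e Ge] : exists e, G (k%:Z *: b, e) by apply/kP; exists 1; rewrite mul1r.
have [d0 d0e] : exists d0 : D, k%:Z *: d0 = e.
  have [k0|k0] := eqVneq k%:Z 0; last exact: divD.
  by exists 0; move: Ge; rewrite k0 !scale0r => /sv ->.
have dE n d : G (n *: b, d) -> d = n *: d0.
  move=> Gd; have [q nE] : exists q, n = q * k%:Z by apply/kP; exists d.
  apply: (single_valued_eq HG sv Gd); rewrite nE -!scalerA d0e.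
  exact: (submoduleZ q HG Ge).
pose G' : set (B * D) :=
  [set p | exists n : int, G (p.1 - n *: b, p.2 - n *: d0)].
exists d0; suff <- : G' = G.
  by exists 1; rewrite !scale1r !subrr; apply: (submodule0 HG).
apply: Gmax.
- apply: submoduleP => [|a [x y] [x' y'] [n Gn] [m Gm]].
    by exists 0; rewrite /= !scale0r !subr0; apply: (submodule0 HG).
  exists (a * n + m) => /=; have := submoduleL a HG Gn Gm.
  congr G; congr pair => /=;
    by rewrite scalerDl scalerBr scalerA opprD addrACA.
- by move=> [x y] Gxy; exists 0; rewrite /= !scale0r !subr0.
apply/seteqP; split=> // -[x y] [[n /= Gn] [/= x0 y0]]; apply: y0.
move: Gn; rewrite x0 sub0r -scaleNr => /dE /eqP.
by rewrite scaleNr subr_eq addNr => /eqP.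
Qed.

Lemma divisible_injective (D : lmodType int) :
  (forall n : int, n != 0 -> forall d : D, exists e : D, n *: e = d) ->
  injective_module D.
Proof.
move=> divD A B f g finj.
have [||h hP] := @divisible_extension B D (range (fun a => (f a, g a))) divD.
- apply: submoduleP => [|a _ _ [x _ <-] [y _ <-]].
    by exists 0 => //; rewrite !linear0.
  by exists (a *: x + y) => //; rewrite !linearP.
- move=> d [a _ [fa <-]].
  by rewrite (finj a 0) ?linear0.
by exists h => x; apply: hP; exists x.
Qed.

Fact Zrat_submodule :
  @submodule int (zmodule rat) [set q : rat | q \is a Num.int].
Proof.
apply: submoduleP => [|a u v uI vI]; first exact: rpred0.
by apply: rpredD => //; apply: rpredMz.
Qed.

Definition QmodZ : lmodType int := quotmod Zrat_submodule.

Definition QmodZ_pi (q : rat) : QmodZ := quotmod_pi Zrat_submodule q.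

Lemma QmodZ_pi0 q : (QmodZ_pi q = 0) <-> (q \is a Num.int).
Proof.
rewrite -[0](linear0 (quotmod_pi Zrat_submodule)) quotmod_piE subr0.
by split.
Qed.

Lemma QmodZ_piZ (n : int) q : n *: QmodZ_pi q = QmodZ_pi (n%:~R * q).
Proof.
rewrite /QmodZ_pi mulrzl.
by rewrite -[q *~ n]/(n *: (q : zmodule rat)) linearZ.
Qed.

Lemma QmodZ_divisible (n : int) :
  n != 0 -> forall d : QmodZ, exists e : QmodZ, n *: e = d.
Proof.
move=> n0 d; have [q <-] := quotmod_pi_surj d.
exists (QmodZ_pi (q / n%:~R)); rewrite QmodZ_piZ mulrC divfK //.
by rewrite intr_eq0.
Qed.

(** Send a to 1/k where k is the order of a, or to 1/2 if the order is infinite;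
    this is well defined on the multiples of a and extends to A. *)
Lemma QmodZ_cogenerator (A : lmodType int) (a : A) :
  a != 0 -> exists chi : {linear A -> QmodZ}, chi a != 0.
Proof.
move=> a0.
have [|k kP] := @int_ideal_principal [set n | n *: a = 0].
  apply: (@submoduleP int int^o) => [|c n m /= na ma]; first exact: scale0r.
  by rewrite scalerDl -scalerA na ma scaler0 addr0.
have k1 : k != 1%N.
  apply: contra a0 => /eqP k1; apply/eqP; rewrite -[a]scale1r.
  by apply/kP; exists 1; rewrite k1.
(* k = 0 means that a has infinite order. *)
pose m : nat := if k == 0%N then 2 else k.
have m1 : (1 < m)%N by rewrite /m; case: k k1 {kP m} => [|[]].
pose d := QmodZ_pi (m%:R)^-1.
have d0 : d != 0.
  apply/eqP => /QmodZ_pi0 /intrP[z zE].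
  have mq0 : (m%:R : rat) != 0 by rewrite pnatr_eq0 -lt0n ltnW.
  have : (z * m%:Z)%:~R = 1 :> rat by rewrite intrM -zE mulVf.
  move=> /eqP; rewrite -[1]/(1%:~R) eqr_int => /eqP.
  move=> /(congr1 absz); rewrite abszM => /eqP.
  rewrite /= muln_eq1 => /andP[_ /eqP m1'].
  by rewrite m1' in m1.
have [||chi chiP] := @divisible_extension A QmodZ
    (range (fun n : int => (n *: a, n *: d))) QmodZ_divisible.
- apply: submoduleP => [|c _ _ [x _ <-] [y _ <-]].
    by exists 0 => //; rewrite !scale0r.
  by exists (c * x + y) => //; rewrite !scalerDl -!scalerA.
- move=> _ [n _ [na <-]]; have [q ->] : exists q, n = q * k%:Z by apply/kP.
  rewrite QmodZ_piZ; apply/QmodZ_pi0; rewrite intrM /m.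
  have [->|k0] := eqVneq k 0%N; first by rewrite mulr0 mul0r rpred0.
  by rewrite mulfK ?intr_int // intr_eq0.
exists chi; suff -> : chi a = d by [].
by apply: chiP; exists 1; rewrite ?scale1r.
Qed.

End IntegerModules.

(** * Injective hulls *)

Section Coinduction.
Variable R : comNzRingType.

Section Action.
Variable D : lmodType int.

Fact additive_submodule :
  @submodule int (R -> D)
    [set f : R -> D | forall s t, f (s + t) = f s + f t].
Proof.
apply: submoduleP => [s t|a f g fD gD s t]; first by rewrite addr0.
have E x : (a *: f + g) x = a *: f x + g x by [].
by rewrite !E fD gD scalerDr addrACA.
Qed.

(** The R-module of additive maps from R to D, on which a acts by precomposition
    with the multiplication by a.  It is cut out of the maps R -> D as a module
    over the integers, since this action is distributive in a only on additive
    maps. *)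
Definition coinduced : Type := submod additive_submodule.
HB.instance Definition _ := GRing.Zmodule.on coinduced.

Definition coinduced_fun (f : coinduced) : R -> D := val f.

Definition mk_coinduced (f : R -> D)
  (fD : forall s t, f (s + t) = f s + f t) : coinduced :=
  mk_submod additive_submodule fD.

Lemma coinducedP (f g : coinduced) :
  coinduced_fun f =1 coinduced_fun g -> f = g.
Proof. by move=> fg; apply/val_inj/funext. Qed.

Lemma coinduced_funD (f : coinduced) s t :
  coinduced_fun f (s + t) = coinduced_fun f s + coinduced_fun f t.
Proof. exact: (submod_valP f). Qed.

Lemma coinduced_addE (f g : coinduced) s :
  coinduced_fun (f + g) s = coinduced_fun f s + coinduced_fun g s.
Proof. by []. Qed.

Definition coinduced_scale (a : R) (f : coinduced) : coinduced.
Proof.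
apply: (@mk_coinduced (fun s => coinduced_fun f (s * a))) => s t.
by rewrite mulrDl coinduced_funD.
Defined.

Lemma coinduced_scaleE a f s :
  coinduced_fun (coinduced_scale a f) s = coinduced_fun f (s * a).
Proof. by []. Qed.

Fact coinduced_scaleA a b f :
  coinduced_scale a (coinduced_scale b f) = coinduced_scale (a * b) f.
Proof. by apply: coinducedP => s; rewrite !coinduced_scaleE mulrA. Qed.

Fact coinduced_scale1 : left_id 1 coinduced_scale.
Proof. by move=> f; apply: coinducedP => s; rewrite coinduced_scaleE mulr1. Qed.

Fact coinduced_scaleDr : right_distributive coinduced_scale +%R.
Proof. by move=> a f g; apply: coinducedP. Qed.

Fact coinduced_scaleDl f : {morph coinduced_scale^~ f : a b / a + b}.
Proof.
move=> a b; apply: coinducedP => s.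
by rewrite coinduced_addE !coinduced_scaleE mulrDr coinduced_funD.
Qed.

HB.instance Definition _ := GRing.Zmodule_isLmodule.Build R coinduced
  coinduced_scaleA coinduced_scale1 coinduced_scaleDr coinduced_scaleDl.

Lemma coinducedZE a f s : coinduced_fun (a *: f) s = coinduced_fun f (s * a).
Proof. by []. Qed.

End Action.

Lemma additive_linear (A : zmodType) (D : lmodType int) (f : A -> D) :
    {morph f : x y / x + y} ->
  exists h : {linear zmodule A -> D}, h =1 f.
Proof.
move=> fD; apply: (@linear_bundle int (zmodule A) D f) => n x y.
have f0 : f 0 = 0 by apply: (addrI (f 0)); rewrite -fD !addr0.
have fN z : f (- z) = - f z.
  by apply/eqP; rewrite -addr_eq0 -fD addNr f0.
have fn (k : nat) z : f (z *+ k) = f z *+ k.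
  by elim: k => [|k IH]; rewrite ?mulr0n // !mulrS fD IH.
rewrite fD; congr (_ + _).
case: n => k; first by rewrite [LHS]fn -scaler_nat natz.
by rewrite [LHS]fN fn NegzE scaleNr -natz scaler_nat.
Qed.

(** Linear maps into the coinduced module correspond to additive maps into D by
    evaluation at 1; so extending the former is extending the latter. *)
Lemma coinduced_injective (D : lmodType int) :
  injective_module D -> injective_module (coinduced D).
Proof.
move=> injD A B f g finj.
have [f' f'E] : exists h : {linear zmodule A -> zmodule B}, h =1 f.
  by apply: (@additive_linear A (zmodule B)); apply: raddfD.
have [g' g'E] : exists h : {linear zmodule A -> D},
    h =1 fun a => coinduced_fun (g a) 1.
  by apply: additive_linear => x y; rewrite raddfD coinduced_addE.
have [|h hf] := injD (zmodule A) (zmodule B) f' g'.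
  by move=> x y; rewrite !f'E => /finj.
have hE b : forall s t,
    h (((s + t) *: b) : B) = h ((s *: b) : B) + h ((t *: b) : B).
  by move=> s t; rewrite scalerDl; apply: raddfD.
have [|k kE] := @linear_bundle R B (coinduced D) (fun b => mk_coinduced (hE b)).
  move=> a x y; apply: coinducedP => s; rewrite coinduced_addE coinducedZE.
  rewrite /coinduced_fun /= scalerDr scalerA.
  exact: raddfD.
exists k => a; rewrite kE; apply: coinducedP => s.
rewrite /coinduced_fun /= -linearZ -[f _]f'E hf g'E linearZ.
by rewrite coinducedZE mul1r.
Qed.

Lemma injective_power (X : Type) (E : lmodType R) :
  injective_module E -> injective_module (X -> E).
Proof.
move=> injE A B f g finj.
have /choice[h hP] x : exists h : {linear B -> E}, forall a, h (f a) = g a x.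
  have [|gx gxE] := @linear_bundle R A E (fun a => g a x).
    by move=> c a b; rewrite linearP.
  by have [h hE] := injE A B f gx finj; exists h => a; rewrite hE gxE.
have [|k kE] := @linear_bundle R B (X -> E) (fun b x => h x b).
  by move=> c a b; apply: funext => x; rewrite linearP.
by exists k => a; rewrite kE; apply: funext => x; apply: hP.
Qed.

(** The module M embeds in a power of the coinduced module of Q/Z, indexed by
    the characters of M: a character chi sends m to the additive map
    s |-> chi (s m), and characters separate the elements of M. *)
Lemma enough_injectives (M : lmodType R) :
  exists E : lmodType R, exists2 j : {linear M -> E},
    injective_module E & injective j.
Proof.
pose X := {linear zmodule M -> QmodZ}.
have add_chi (chi : X) (m : M) s t :
    chi (((s + t) *: m) : M) = chi ((s *: m) : M) + chi ((t *: m) : M).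
  by rewrite scalerDl; apply: raddfD.
exists (X -> coinduced QmodZ).
have [|j jE] := @linear_bundle R M (X -> coinduced QmodZ)
    (fun m chi => mk_coinduced (add_chi chi m)).
  move=> a x y; apply: funext => chi; apply: coinducedP => s.
  rewrite [RHS]coinduced_addE coinducedZE.
  by rewrite /coinduced_fun /= scalerDr scalerA; apply: raddfD.
exists j.
  apply: injective_power; apply: coinduced_injective.
  by apply: divisible_injective; apply: QmodZ_divisible.
move=> x y; rewrite !jE => xy; apply/eqP; rewrite -subr_eq0.
apply: contrapT => /negP xy0.
have [chi] := @QmodZ_cogenerator (zmodule M) (x - y) xy0.
rewrite raddfB /= => /eqP; apply; apply/eqP; rewrite subr_eq0; apply/eqP.
have := congr1 (fun f => coinduced_fun (f chi) 1) xy.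
by rewrite /coinduced_fun /= !scale1r.
Qed.

(** Embed M in an injective E, take C maximal among the submodules meeting the
    image of M in 0, then N maximal among those containing M and meeting C in 0.
    Maximality of C makes N essential over M.  The projection of the direct sum
    of N and C onto N extends to an endomorphism phi of E, because E is
    injective; the preimage of C under phi contains C and meets M in 0, so it is C;
    as phi vanishes on C, the range of phi meets C in 0, and by maximality of N
    it is N.  So N is a retract of E, hence injective. *)
Lemma injective_hull_exists (M : lmodType R) :
  exists (E : lmodType R) (i : {linear M -> E}), injective_hull i.
Proof.
have [E [j injE jinj]] := enough_injectives M.
have Hj := range_submodule j.
have H0 : @submodule R E [set 0].
  by apply: submoduleP => // a _ _ -> ->; rewrite scaler0 addr0.
have [|C [HC _ CA Cmax]] := submodule_avoiding (A := range j `\ 0) H0.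
  by apply/seteqP; split=> // x [-> [_ n0]]; apply: n0.
have Cj x : C x -> range j x -> x = 0.
  move=> Cx jx; apply: contrapT => x0.
  by rewrite -[False]/((set0 : set E) x) -CA; split.
have [|N [HN jN NA Nmax]] := submodule_avoiding (A := C `\ 0) Hj.
  by apply/seteqP; split=> // x [jx [Cx x0]]; apply/x0/Cj.
have NC x : N x -> C x -> x = 0.
  move=> Nx Cx; apply: contrapT => x0.
  by rewrite -[False]/((set0 : set E) x) -NA; split.
pose A : lmodType R := (submod HN * submod HC)%type.
have [|f fE] := @linear_bundle R A E (fun p => val p.1 + val p.2).
  by move=> a x y; rewrite /= scalerDr addrACA.
have [|g gE] := @linear_bundle R A E (fun p => val p.1).
  by [].
have [|phi phiE] := injE A E f g.
  move=> [n c] [n' c']; rewrite !fE /= => /eqP.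
  rewrite -subr_eq0 opprD addrACA addr_eq0 => /eqP ncE.
  have n0 : val n - val n' = 0.
    apply: NC; first by apply: (submoduleB HN); apply: submod_valP.
    by rewrite ncE; apply/(submoduleN HC)/(submoduleB HC); apply: submod_valP.
  move: ncE; rewrite n0 => /esym/eqP.
  rewrite oppr_eq0 subr_eq0 => /eqP /val_inj ->.
  by move/eqP: n0; rewrite subr_eq0 => /eqP /val_inj ->.
have phiN x : N x -> phi x = x.
  move=> Nx; have := phiE (mk_submod HN Nx, 0).
  by rewrite fE gE /= addr0.
have phiC x : C x -> phi x = 0.
  move=> Cx; have := phiE (0, mk_submod HC Cx).
  by rewrite fE gE /= add0r.
have phi_preim (K : set E) : submodule K -> submodule (phi @^-1` K).
  move=> HK; apply: submoduleP => [|a x y Kx Ky] /=.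
    by rewrite linear0; apply: submodule0.
  by rewrite linearP; apply: submoduleL.
have phi_im : range phi = N.
  have Himage := range_submodule phi.
  apply: Nmax => // [x Nx|]; first by exists x => //; apply: phiN.
  have LC : phi @^-1` C = C.
    apply: Cmax; first exact: phi_preim.
      by move=> c Cc /=; rewrite phiC //; apply: submodule0.
    apply/seteqP; split=> // x [Cx [jx x0]]; apply: x0.
    apply: NC; first exact: jN.
    by rewrite -(phiN x) //; apply: jN.
  apply/seteqP; split=> // _ [[x _ <-] [Cx x0]]; apply: x0.
  by apply: phiC; rewrite -LC.
have Nphi x : N (phi x) by rewrite -phi_im; exists x.
have Nj x : N (j x) by apply: jN; exists x.
exists (submod HN).
have [|i iE] := @linear_bundle R M (submod HN) (fun x => mk_submod HN (Nj x)).
  by move=> a x y; apply: val_inj; rewrite /= linearP.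
exists i; split.
- move=> P Q u v uinj.
  have [|v' v'E] := @linear_bundle R P E (fun x => val (v x)).
    by move=> a x y; rewrite linearP.
  have [h hE] := injE P Q u v' uinj.
  have [|k kE] := @linear_bundle R Q (submod HN)
    (fun q => mk_submod HN (Nphi (h q))).
    by move=> a x y; apply: val_inj; rewrite /= !linearP.
  exists k => x; apply: val_inj; rewrite kE /= hE v'E phiN //.
  exact: submod_valP.
- by move=> x y; rewrite !iE => /(congr1 val) /= /jinj.
move=> K HK Ki.
(* If K meets the image of M in 0, so does C + K, which is therefore C. *)
have HK' : submodule (fun c => exists2 y, K y & C (c - val y)).
  apply: submoduleP => [|a x x' [y Ky Cy] [y' Ky' Cy']].
    by exists 0; rewrite ?subrr; apply: submodule0.
  exists (a *: y + y'); first exact: submoduleL.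
  have := submoduleL a HC Cy Cy'.
  by rewrite scalerBr addrACA -opprD.
have K'C : (fun c => exists2 y, K y & C (c - val y)) = C.
  apply: Cmax => //.
    by move=> c Cc; exists 0; rewrite ?subr0 //; apply: submodule0.
  apply/seteqP; split=> // x [[y Ky Cy] [[m _ mx] x0]]; apply: x0.
  have : x - val y = 0.
    apply: NC => //; apply: (submoduleB HN); last exact: submod_valP.
    by rewrite -mx.
  move/eqP; rewrite subr_eq0 => /eqP xy; rewrite xy.
  suff -> : y = 0 by [].
  rewrite -[y = 0]/([set 0] y) -Ki; split=> //; exists m => //.
  by apply: val_inj; rewrite iE /= mx xy.
apply/seteqP; split=> [y Ky|_ ->]; last exact: submodule0.
apply: val_inj; apply: NC; first exact: submod_valP.
by rewrite -K'C; exists y => //; rewrite subrr; apply: submodule0.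
Qed.

End Coinduction.

(** * Simple modules and maximal ideals *)

Section Simple.
Variable R : comNzRingType.
Implicit Types (I m : set R) (x y : R).

Lemma maximal_ideal_above I :
  ideal I -> ~ I 1 -> exists2 m, maximal_ideal m & I `<=` m.
Proof.
move=> HI I1.
have [|m [Hm Im m1 mmax]] := @submodule_avoiding R R^o [set 1] I HI.
  by apply/seteqP; split=> // x [Ix x1]; apply: I1; rewrite -x1.
have m1' : ~ m 1 by move=> m1'; rewrite -[False]/(set0 (1 : R)) -m1; split.
exists m => //; split=> // [mT|J HJ mJ]; first by apply: m1'; rewrite mT.
have [J1|J1] := pselect (J 1).
  by right; apply/seteqP; split=> // x _; rewrite -[x]mulr1; apply: idealM.
left; apply: mmax => //; apply/seteqP; split=> // x [Jx x1].
by apply: J1; rewrite -x1.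
Qed.

(** R/m is a field. *)
Lemma maximal_ideal_inverse m r :
  maximal_ideal m -> ~ m r -> exists t, m (1 - t * r).
Proof.
case=> Hm mT mmax mr.
pose J : set R := [set x | exists t, m (x - t * r)].
have HJ : ideal J.
  apply: (@submoduleP R R^o) => [|a x y [s ms] [t mt]].
    by exists 0; rewrite mul0r subr0; apply: (@submodule0 R R^o).
  exists (a * s + t).
  rewrite mulrDl opprD addrACA -mulrA -mulrBr.
  exact: (@submoduleL R R^o m a _ _ Hm ms mt).
have [|Jm|JT] := mmax J HJ.
- by move=> x mx; exists 0; rewrite mul0r subr0.
- case: mr; rewrite -Jm; exists 1; rewrite mul1r subrr.
  exact: (@submodule0 R R^o).
by have : J 1 by rewrite JT.
Qed.

Lemma simple_quotient m (Hm : ideal m) :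
  maximal_ideal m -> simple_module (quotmod Hm : lmodType R).
Proof.
move=> [_ mT mmax]; split.
  exists (quotmod_pi Hm 1); apply/eqP => pi1.
  apply: (proper_ideal1 Hm mT); rewrite -[1]subr0.
  by apply/(quotmod_piE Hm); rewrite linear0.
move=> N HN; pose I : set R := [set x | N (quotmod_pi Hm x)].
have HI : ideal I.
  apply: (@submoduleP R R^o) => [|a x y Nx Ny] /=.
    by rewrite /I /= linear0; apply: submodule0.
  by rewrite /I /= linearP; apply: submoduleL.
have [|Im|IT] := mmax I HI.
- move=> x mx; rewrite /I /=.
  suff -> : quotmod_pi Hm x = 0 by apply: submodule0.
  by rewrite -(linear0 (quotmod_pi Hm)); apply/quotmod_piE; rewrite subr0.
- left; apply/seteqP; split=> [q Nq|_ ->]; last exact: submodule0.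
  have [x xq] := quotmod_pi_surj q; rewrite -xq /=.
  rewrite -(linear0 (quotmod_pi Hm)); apply/quotmod_piE; rewrite subr0 -Im.
  by rewrite /I /= xq.
right; apply/seteqP; split=> // q _; have [x <-] := quotmod_pi_surj q.
by have : I x by rewrite IT.
Qed.

Lemma simple_generated (S : lmodType R) (s0 : S) :
  simple_module S -> s0 != 0 -> forall s, exists r, s = r *: s0.
Proof.
move=> [_ Smin] s00 s.
have [|I0|IT] := Smin (range ( *:%R^~ s0)).
- apply: submoduleP => [|a _ _ [x _ <-] [y _ <-]].
    by exists 0; rewrite ?scale0r.
  by exists (a * x + y) => //; rewrite scalerDl scalerA.
- have : range ( *:%R^~ s0) s0 by exists 1; rewrite ?scale1r.
  by rewrite I0 => s0E; rewrite s0E eqxx in s00.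
have : range ( *:%R^~ s0) s by rewrite IT.
by case=> r _ <-; exists r.
Qed.

Lemma simple_annihilator_maximal (S : lmodType R) (s0 : S) :
  simple_module S -> s0 != 0 -> maximal_ideal [set r : R | r *: s0 = 0].
Proof.
move=> simS s00; split.
- apply: (@submoduleP R R^o) => [|a x y /= x0 y0]; first exact: scale0r.
  by rewrite scalerDl -scalerA x0 y0 scaler0 addr0.
- move=> mT; move/eqP: s00; apply; rewrite -[s0]scale1r.
  by rewrite -[_ = 0]/([set r : R | r *: s0 = 0] 1) mT.
move=> J HJ mJ.
have [Jm|/existsNP[x /not_implyP[Jx x0]]] :=
  pselect (J `<=` [set r : R | r *: s0 = 0]); first by left; apply/seteqP.
right; apply/seteqP; split=> // y _.
have xs0 : x *: s0 != 0 by apply/eqP.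
have [t tE] := simple_generated simS xs0 (y *: s0).
have -> : y = (y - t * x) + t * x by rewrite subrK.
apply: (@submoduleD R R^o) => //; last exact: idealM.
by apply: mJ; rewrite /= scalerBl -scalerA -tE subrr.
Qed.

Lemma maximal_mul_eq0 m (M : lmodType R) (y : M) r :
  maximal_ideal m -> (forall a, m a -> a *: y = 0) -> ~ m r ->
  r *: y = 0 -> y = 0.
Proof.
move=> maxm my mr ry; have [t /my] := maximal_ideal_inverse maxm mr.
by rewrite scalerBl scale1r -scalerA ry scaler0 subr0.
Qed.

(** Multiplication by x embeds R in itself; the image of 1 under an extension of
    r |-> r e along this embedding is a quotient of e by x. *)
Lemma injective_divisible (E : lmodType R) x (e : E) :
  injective_module E -> ~ zero_divisor x -> exists e', x *: e' = e.
Proof.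
move=> injE xreg.
have [|f fE] := @linear_bundle R R^o R^o (fun r => x * r).
  by move=> a r s; rewrite mulrDr mulrCA.
have [|g gE] := @linear_bundle R R^o E (fun r => r *: e).
  by move=> a r s; rewrite scalerDl scalerA.
have [|h hE] := injE R^o R^o f g.
  move=> r s; rewrite !fE => /eqP; rewrite -subr_eq0 -mulrBr => /eqP rs0.
  apply/eqP; rewrite -subr_eq0; apply: contrapT => /negP rs.
  by apply: xreg; exists (r - s).
exists (h 1); rewrite -linearZ.
by have := hE 1; rewrite fE gE scale1r.
Qed.

(** For x in m and f from an injective E onto R/m with f e = 1, dividing e by x
    in E would give 1 = 0 in R/m, since x kills R/m. *)
Lemma dual_Kasch_classical : dual_Kasch R -> classical_ring R.
Proof.
move=> dK x; have [|xreg] := pselect (zero_divisor x); [by left|right].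
apply: contrapT => xinv.
have [|m maxm xm] := maximal_ideal_above (principal_ideal x).
  by move=> [y _ yx]; apply: xinv; exists y; rewrite mulrC.
have [Hm mT _] := maxm.
have [E injE [f fsurj]] := dK _ (simple_quotient Hm maxm).
have [e _ fe] : range f (quotmod_pi Hm 1) by rewrite fsurj.
have [e' e'E] := injective_divisible e injE xreg.
have [y yE] := quotmod_pi_surj (f e').
apply: (proper_ideal1 Hm mT).
have mxy : m (x * y).
  by rewrite mulrC; apply: idealM => //; apply: xm; exists 1; rewrite ?mul1r.
rewrite -[1](subrK (x * y)); apply: (@submoduleD R R^o) => //.
apply/(quotmod_piE Hm); rewrite -fe -e'E linearZ /= -yE.
by rewrite -linearZ.
Qed.

(** The image of 1 under an embedding of R/m into R is killed by x when x is in
    m. *)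
Lemma Kasch_classical : Kasch R -> classical_ring R.
Proof.
move=> K x; have [|xinv] := pselect (invertible x); [by right|left].
have [|m maxm xm] := maximal_ideal_above (principal_ideal x).
  by move=> [y _ yx]; apply: xinv; exists y; rewrite mulrC.
have [Hm mT _] := maxm.
have [f finj] := K _ (simple_quotient Hm maxm).
exists (f (quotmod_pi Hm 1)).
  apply/eqP; rewrite -(linear0 f) => /finj.
  rewrite -(linear0 (quotmod_pi Hm)) => /quotmod_piE; rewrite subr0.
  exact: proper_ideal1.
rewrite -[x * _]/(x *: (f _ : R^o)) -linearZ -linearZ /=.
rewrite -[RHS](linear0 f) -[in RHS](linear0 (quotmod_pi Hm)); congr (f _).
apply/quotmod_piE; rewrite subr0 -[x *: 1]/(x * 1) mulr1.
by apply: xm; exists 1; rewrite ?mul1r.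
Qed.

Lemma maximal_zero_divisor m :
  classical_ring R -> maximal_ideal m -> forall x, m x -> zero_divisor x.
Proof.
move=> cl [Hm mT _] x mx; have [//|[y xy]] := cl x.
by case: (proper_ideal1 Hm mT); rewrite -xy mulrC; apply: idealM.
Qed.

(** If 1 = sum_k a_k z_k in E with all a_k in m, then a non-zero y killing the
    a_k satisfies i(y) = y i(1) = 0. *)
Lemma classical_hull_proper :
  finite_Goldie_dimension R -> classical_ring R -> hull_maximal_ideals_proper R.
Proof.
move=> hR cl E i [_ iinj _] m maxm mE.
have : ideal_mul m E (i 1) by rewrite mE.
move=> [n [a [z [ma i1]]]].
have [Hm _ _] := maxm.
have [|y y0 yP] := @finite_common_annihilator R m (codom a) hR Hm
    (maximal_zero_divisor cl maxm).
  by move=> _ /codomP[k ->].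
move/eqP: y0; apply; apply: iinj; rewrite linear0.
have -> : y = y *: (1 : R^o) by rewrite -[RHS]/(y * 1) mulr1.
rewrite linearZ /= i1 scaler_sumr big1 // => k _.
by rewrite scalerA mulrC yP ?scale0r // codom_f.
Qed.

Lemma ideal_mul_submodule m (M : lmodType R) :
  ideal m -> submodule (ideal_mul m M).
Proof.
move=> Hm.
apply: submoduleP => [|c _ _ [n [a [u [ma ->]]]] [p [b [v [mb ->]]]]].
  exists 0%N, (fun=> 0), (fun=> 0); split=> [k|].
    exact: (@submodule0 R R^o).
  by rewrite big_ord0.
exists (n + p)%N,
  (fun k => match fintype.split k with inl i => c * a i | inr j => b j end),
  (fun k => match fintype.split k with inl i => u i | inr j => v j end); split.
  by move=> k; case: fintype.split => i //; apply: idealM.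
rewrite big_split_ord scaler_sumr; congr (_ + _).
  by apply: eq_bigr => i _; rewrite (unsplitK (inl i)) scalerA.
by apply: eq_bigr => i _; rewrite (unsplitK (inr i)).
Qed.

(** Take N maximal among the submodules containing mE and avoiding some v.  Each
    e outside N satisfies v = n + r e with n in N and r outside m.  As r is
    invertible modulo m, e is in N + Rv; so n + r v |-> r s0 is defined on E. *)
Lemma factor_onto_simple (E S : lmodType R) m (s0 : S) :
    simple_module S -> s0 != 0 -> m = [set r | r *: s0 = 0] ->
    ideal_mul m E <> setT -> iso_to_factor_module E S.
Proof.
move=> simS s00 mE mET.
have maxm : maximal_ideal m by rewrite mE; apply: simple_annihilator_maximal.
have [Hm mT _] := maxm.
have [v mv] : exists v, ~ ideal_mul m E v.
  by apply/existsNP => H; apply: mET; apply/seteqP; split.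
have [|N [HN mN NA Nmax]] :=
    submodule_avoiding (A := [set v]) (ideal_mul_submodule E Hm).
  by apply/seteqP; split=> // x [mx xv]; apply: mv; rewrite -xv.
have Nv : ~ N v.
  by move=> Nv; rewrite -[False]/((set0 : set E) v) -NA; split.
have Nm r (x : E) : m r -> N (r *: x).
  move=> mr; apply: mN; exists 1%N, (fun=> r), (fun=> x); split=> //.
  by rewrite big_ord1.
(* Modulo N, elements outside m act invertibly. *)
have unit_v r (x : E) : ~ m r -> exists t, N (x - t *: (r *: x)).
  move=> mr; have [t mt] := maximal_ideal_inverse maxm mr; exists t.
  by rewrite scalerA -{1}[x]scale1r -scalerBl; apply: Nm.
have cover (e : E) : exists r, N (e - r *: v).
  have [Ne|Ne] := pselect (N e); first by exists 0; rewrite scale0r subr0.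
  pose D : set E := [set x | exists r, N (x - r *: e)].
  have [r Nr] : D v.
    apply: contrapT => Dv; apply: Ne.
    suff <- : D = N by exists 1; rewrite scale1r subrr; apply: submodule0.
    apply: Nmax.
    - apply: submoduleP => [|a x y [r Nr] [s Ns]].
        by exists 0; rewrite scale0r subr0; apply: submodule0.
      exists (a * r + s); have := submoduleL a HN Nr Ns.
      by rewrite scalerDl scalerBr scalerA opprD addrACA.
    - by move=> x Nx; exists 0; rewrite scale0r subr0.
    by apply/seteqP; split=> // x [Dx xv]; apply: Dv; rewrite -xv.
  have mr : ~ m r.
    move=> mr; apply: Nv; rewrite -[v](subrK (r *: e)).
    by apply: submoduleD => //; apply: Nm.
  have [t Nt] := unit_v r e mr; exists t.
  have -> : e - t *: v = (e - t *: (r *: e)) - t *: (v - r *: e).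
    by rewrite [t *: (v - _)]scalerBr opprB addrA subrK.
  by apply: submoduleB => //; apply: submoduleZ.
pose G : set (E * S) := [set p | exists2 r, N (p.1 - r *: v) & p.2 = r *: s0].
have [|||h hG] := @graph_linear R E S G.
- apply: submoduleP => [|a [x y] [x' y'] [r /= Nr ->] [r' /= Nr' ->]].
    by exists 0; rewrite /= scale0r ?subr0 //; apply: submodule0.
  exists (a * r + r') => /=; last by rewrite scalerDl scalerA.
  have := submoduleL a HN Nr Nr'.
  by rewrite scalerDl scalerBr scalerA opprD addrACA.
- move=> s [r /=]; rewrite sub0r => Nr ->.
  apply: contrapT => rs0; apply: Nv.
  have mr : ~ m r by rewrite mE.
  have [t Nt] := unit_v r v mr.
  rewrite -[v](subrK (t *: (r *: v))); apply: submoduleD => //.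
  by apply: submoduleZ => //; rewrite -[_ *: _]opprK; apply: submoduleN.
- by move=> e; have [r Nr] := cover e; exists (r *: s0), r.
exists h; apply/seteqP; split=> // s _.
have [r ->] := simple_generated simS s00 s.
exists (r *: v) => //; apply: hG; exists r => //=.
by rewrite subrr; apply: submodule0.
Qed.

Lemma hull_proper_dual_Kasch : hull_maximal_ideals_proper R -> dual_Kasch R.
Proof.
move=> hullP S simS; have [[s0 s00] _] := simS.
have [E [i hull]] := injective_hull_exists R^o.
exists E; first by case: hull.
apply: (factor_onto_simple simS s00 erefl).
by apply: (hullP E i hull); apply: simple_annihilator_maximal.
Qed.

Definition double_annihilator (s : seq R) : set R :=
  [set x | forall y, (forall a, a \in s -> a * y = 0) -> x * y = 0].

(** Double annihilators of finite sets grow with the set, so the ascending chain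
    condition bounds them: J has the annihilator of one of its finite parts. *)
Lemma noetherian_finite_annihilator (J : set R) :
  noetherian R -> exists2 s : seq R, (forall a, a \in s -> J a) &
    J `<=` double_annihilator s.
Proof.
move=> noeth; apply: contrapT => nos.
have /choice[F FP] (s : seq R) : exists x, (forall a, a \in s -> J a) ->
    J x /\ ~ double_annihilator s x.
  have [sJ|] := pselect (forall a, a \in s -> J a); last by exists 0.
  have /existsNP[x /not_implyP[Jx xs]] : ~ J `<=` double_annihilator s.
    by move=> Js; apply: nos; exists s.
  by exists x.
pose S n := iter n (fun s => F s :: s) [::].
have SJ n a : a \in S n -> J a.
  elim: n a => [//|n IH] a; rewrite inE => /predU1P[->|]; last exact: IH.
  by case: (FP (S n) IH).
have [||N NP] := noeth (fun n => double_annihilator (S n)).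
- move=> n; apply: (@submoduleP R R^o) => [y _|a x y xs ys z zs].
    by rewrite mul0r.
  by rewrite mulrDl -mulrA xs // ys // mulr0 addr0.
- move=> n x xs y yS; apply: xs => a aS; apply: yS.
  by rewrite inE aS orbT.
case: (FP (S N) (SJ N)) => _; apply.
rewrite -(NP N.+1) // => y; apply; exact: mem_head.
Qed.

(** A non-zero y with m y = 0 gives the map r s0 |-> r y. *)
Lemma classical_Kasch :
  finite_Goldie_dimension R -> noetherian R -> classical_ring R -> Kasch R.
Proof.
move=> hR noeth cl S simS; have [[s0 s00] _] := simS.
set m := [set r : R | r *: s0 = 0].
have maxm : maximal_ideal m by apply: simple_annihilator_maximal.
have [Hm mT _] := maxm.
have [s sm ms] := noetherian_finite_annihilator m noeth.
have [y y0 sy] :=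
  finite_common_annihilator hR Hm (maximal_zero_divisor cl maxm) sm.
have my a : m a -> a * y = 0 by move=> /ms; apply.
pose G : set (S * R^o) := range (fun r : R => (r *: s0, (r * y : R^o))).
have [|||f fG] := @graph_linear R S R^o G.
- apply: submoduleP => [|a _ _ [r _ <-] [r' _ <-]].
    by exists 0; rewrite ?scale0r ?mul0r.
  by exists (a * r + r') => //; rewrite scalerDl -scalerA mulrDl -mulrA.
- by move=> _ [r _ [r0 <-]]; apply: my.
- move=> t; have [r ->] := simple_generated simS s00 t.
  by exists (r * y), r.
have fE r : f (r *: s0) = r * y by apply: fG; exists r.
exists f => u v /eqP; rewrite -subr_eq0 -linearB => /eqP fuv.
apply/eqP; rewrite -subr_eq0; apply/eqP; move: fuv.
have [r ->] := simple_generated simS s00 (u - v); rewrite fE => ry.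
apply: contrapT => mr; move/eqP: y0; apply.
exact: (@maximal_mul_eq0 m R^o y r maxm my mr ry).
Qed.

End Simple.

(** * The equivalences *)

Theorem theorem3p4 (R : comNzRingType) (hR : finite_Goldie_dimension R) :
  [<-> dual_Kasch R;
       classical_ring R;
       hull_maximal_ideals_proper R] /\
  (noetherian R ->
   [<-> dual_Kasch R;
        classical_ring R;
        hull_maximal_ideals_proper R;
        Kasch R]).
Proof.
have ab := @dual_Kasch_classical R.
have bc := classical_hull_proper hR.
have ca := @hull_proper_dual_Kasch R.
split=> [|noeth]; tfae => //.
  by move=> c; apply/(classical_Kasch hR noeth)/ab/ca.
by move=> d; apply/ca/bc/Kasch_classical.
Qed.
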